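(* For every integer $n\ge 2$, the random vectors $\bm{V}_n$ and $\bm{W}_n$ in $\mathbb{R}^{n-1}$ (the point-to-line and line-to-line last passage percolation vectors with i.i.d. rate-$1$ exponential weights) have the same joint distribution: $\bm{V}_n \overset{D}{=} \bm{W}_n$.
   Context: Let $\mathbb{N}=\{1,2,3,\dots\}$ and let $(X_{i,j})_{i,j\ge 1}$ be i.i.d. exponential random variables of rate $1$. For $(a,b),(c,d)\in\mathbb{N}^2$, a directed lattice path from $(a,b)$ to $(c,d)$ is a sequence $((i_k,j_k))_{k=0}^m$ in $\mathbb{N}^2$ of minimal length $m=|c-a|+|d-b|$ with $(i_0,j_0)=(a,b)$, $(i_m,j_m)=(c,d)$ and $|i_{k+1}-i_k|+|j_{k+1}-j_k|=1$ for all $0\le k<m$. The last passage percolation (LPP) time is $$L(a,b;c,d):=\max_{\pi:(a,b)\to(c,d)}\ \sum_{(i,j)\in\pi}X_{i,j},$$ the maximum being over all directed lattice paths $\pi$ from $(a,b)$ to $(c,d)$. Define the random vectors, on the same environment, $$\bm{V}_n=(V_n(1),\dots,V_n(n-1)),\quad V_n(k):=L(1,1;n-k,k),$$ $$\bm{W}_n=(W_n(1),\dots,W_n(n-1)),\quad W_n(k):=L(n-k,1;1,k).$$ $\overset{D}{=}$ denotes equality of (joint) distributions. *)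

(* Defs.v *)
From HB Require Import structures.
From mathcomp Require Import all_boot all_order all_algebra finmap zify.
From mathcomp Require Import all_classical all_reals all_analysis measurable_realfun.

Set Implicit Arguments.
Unset Strict Implicit.
Unset Printing Implicit Defensive.

Import Order.TTheory GRing.Theory Num.Theory.
Import numFieldNormedType.Exports.

Local Open Scope classical_set_scope.
Local Open Scope ring_scope.

Section probability_notions.
Context {d : measure_display} {T : measurableType d} {R : realType}.
Variable P : probability T R.

(* The probability of a non-measurable set is unconstrained, so laws are
   compared on measurable sets only. *)
Definition has_law {d'} {T' : measurableType d'} (X : {RV P >-> T'})
    (mu : set T' -> \bar R) : Prop :=
  forall A, measurable A -> distribution P X A = mu A.

Definition eq_in_law {d'} {T' : measurableType d'} (X Y : {RV P >-> T'}) :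
    Prop :=
  has_law X (distribution P Y).

Definition mutually_independent {I : choiceType} {d'} {T' : measurableType d'}
    (D : set I) (X : I -> {RV P >-> T'}) : Prop :=
  forall (J : {fset I}) (A : I -> set T'),
    [set` J] `<=` D -> (forall i, i \in J -> measurable (A i)) ->
    P (\bigcap_(i in [set` J]) (X i @^-1` A i)) =
    (\prod_(i <- J) P (X i @^-1` A i))%E.

End probability_notions.

Notation site := (nat * nat)%type.

(* Sites live in {1, 2, 3, ...}^2; values attached to a site with a zero
   coordinate are never used. *)
Definition quadrant (u : site) : bool := (0 < u.1)%N && (0 < u.2)%N.

Definition dist1 (u v : site) : nat := (`|v.1 - u.1| + `|v.2 - u.2|)%N.

Definition adjacent (u v : site) : bool := dist1 u v == 1%N.

(* The path is u :: p, so that size p is its number of steps. *)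
Definition lattice_path (u v : site) (p : seq site) : bool :=
  [&& all quadrant (u :: p), path adjacent u p, last u p == v
    & size p == dist1 u v].

(* On quadrant sites this sup ranges over a finite nonempty set, hence is a
   maximum: see lpp_max. *)
Definition lpp {R : realType} (x : site -> R) (u v : site) : R :=
  sup [set \sum_(s <- u :: p) x s | p in [set p | lattice_path u v p]].

Lemma finite_adjacent_path (m : nat) (u : site) :
  finite_set [set p | path adjacent u p /\ size p = m].
Proof.
elim: m u => [|m IHm] u.
  apply: (@sub_finite_set _ _ [set [::]]); last exact: finite_set1.
  by move=> p [_ /size0nil].
pose N : set site := `I_(u.1.+2) `*` `I_(u.2.+2).
apply: (@sub_finite_set _ _
  (\bigcup_(v in N) (cons v @` [set p | path adjacent v p /\ size p = m]))).
  case=> [|v p] [] //= /andP[uv vp] [sp]; exists v; last by exists p.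
  move: uv; rewrite /adjacent /dist1 => /eqP uv.
  have H (a b c : nat) : (`|b - a| + c = 1 -> b < a.+2)%N by lia.
  split => /=; first exact: H uv.
  by apply: H; rewrite addnC; exact: uv.
apply: bigcup_finite; first by apply: finite_setX; exact: finite_II.
by move=> v _; apply: finite_image; exact: IHm.
Qed.

Lemma finite_lattice_path (u v : site) :
  finite_set [set p | lattice_path u v p].
Proof.
apply: sub_finite_set (finite_adjacent_path (dist1 u v) u).
by move=> p /and4P[_ up _ /eqP].
Qed.

Lemma lattice_path_ex (u v : site) :
  quadrant u -> quadrant v -> exists p, lattice_path u v p.
Proof.
move: u v => [a b] [c d].
move em : (dist1 (a, b) (c, d)) => m.
elim: m a b em => [|m IHm] a b.
  rewrite /dist1 /= => duv qu _; exists [::].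
  rewrite /lattice_path /= qu /= /dist1 /= duv eqxx andbT.
  by apply/eqP; congr pair; lia.
move=> duv qu qv.
have [[a' b'] [adj qw dwv]] : exists w, [/\ adjacent (a, b) w, quadrant w
    & dist1 w (c, d) = m].
  move: duv qu qv; rewrite /adjacent /dist1 /quadrant /= => duv qu qv.
  have [ac|ca|ac] := ltngtP a c.
  - by exists (a.+1, b); split => /=; lia.
  - by exists (a.-1, b); split => /=; lia.
  have [bd|db|bd] := ltngtP b d.
  - by exists (a, b.+1); split => /=; lia.
  - by exists (a, b.-1); split => /=; lia.
  by exfalso; lia.
have [p /and4P[qp wp lp /eqP sp]] := IHm _ _ dwv qw qv.
exists ((a', b') :: p); apply/and4P; split => //=.
- by rewrite qu.
- by rewrite adj.
- by rewrite sp dwv duv.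
Qed.

Section finite_sup.
Context {R : realType} {I : eqType}.

Lemma bigmax_mem (x : I) (r : seq I) (F : I -> R) :
  exists2 i, i \in x :: r & \big[Num.max/F x]_(j <- r) F j = F i.
Proof.
elim: r => [|y r [i ir e]]; first by exists x; rewrite ?mem_head ?big_nil.
rewrite big_cons e; have [_|_] := leP (F y) (F i).
  by exists i => //; move: ir; rewrite !inE => /orP[->//|->]; rewrite !orbT.
by exists y => //; rewrite !inE eqxx orbT.
Qed.

Lemma sup_seqE (x : I) (r : seq I) (F : I -> R) :
  sup [set F i | i in [set` x :: r]] = \big[Num.max/F x]_(j <- r) F j.
Proof.
have ub : ubound [set F i | i in [set` x :: r]]
    (\big[Num.max/F x]_(j <- r) F j).
  move=> _ [i /= + <-]; rewrite inE => /orP[/eqP ->|ir].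
    exact: bigmax_ge_id.
  exact: le_bigmax_seq.
apply/le_anti/andP; split.
  by apply: ge_sup => //; exists (F x), x => //=; rewrite mem_head.
have [i ir ->] := bigmax_mem x r F.
by apply: ub_le_sup; [exists (\big[Num.max/F x]_(j <- r) F j)|exists i].
Qed.

End finite_sup.

Lemma lpp_max {R : realType} (x : site -> R) (u v : site) :
  quadrant u -> quadrant v ->
  (exists2 p, lattice_path u v p & lpp x u v = \sum_(s <- u :: p) x s) /\
  (forall p, lattice_path u v p -> \sum_(s <- u :: p) x s <= lpp x u v).
Proof.
move=> qu qv; have [p0 p0P] := lattice_path_ex qu qv.
have /finite_seqP[[|q r] rE] := finite_lattice_path u v.
  by have : [set p | lattice_path u v p] p0 by []; rewrite rE.
have rP p : lattice_path u v p = (p \in q :: r).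
  by apply/idP/idP => h; [have : [set` q :: r] p by rewrite -rE
    | have : [set p | lattice_path u v p] p by rewrite rE].
rewrite /lpp rE (sup_seqE _ _ (fun p => \sum_(s <- u :: p) x s)); split.
  have [p pr e] := bigmax_mem q r (fun p => \sum_(s <- u :: p) x s).
  by exists p => //; rewrite rP.
move=> p; rewrite rP inE => /orP[/eqP ->|pr]; first exact: bigmax_ge_id.
exact: (@le_bigmax_seq _ _ _ _ _ _ xpredT (fun p => \sum_(s <- u :: p) x s)).
Qed.

Section random_environment.
Context {d : measure_display} {T : measurableType d} {R : realType}.
Context {P : probability T R}.

Definition iid_exponential (X : site -> {RV P >-> R}) : Prop :=
  mutually_independent [set` quadrant] X /\
  (forall s, quadrant s -> has_law (X s) (exponential_prob 1)).

Lemma measurable_lpp (X : site -> {RV P >-> R}) (u v : site) :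
  measurable_fun [set: T] (fun w => lpp (X ^~ w) u v).
Proof.
have /finite_seqP[r rE] := finite_lattice_path u v.
rewrite /lpp rE; case: r {rE} => [|q r].
  under eq_fun do rewrite set_nil image_set0 sup0.
  exact: measurable_cst.
under eq_fun do rewrite (sup_seqE _ _ (fun p => \sum_(s <- u :: p) X s _)).
have mS p : measurable_fun [set: T] (fun w => \sum_(s <- u :: p) X s w).
  by apply: measurable_sum => s; exact: measurable_funPT.
elim: r => [|p r IHr].
  under eq_fun do rewrite big_nil.
  exact: mS.
under eq_fun do rewrite big_cons.
exact: measurable_maxr.
Qed.

Definition lpp_vector (X : site -> {RV P >-> R}) {m : nat}
    (u v : 'I_m -> site) (w : T) : m.-tuple R :=
  [tuple lpp (X ^~ w) (u i) (v i) | i < m].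

Lemma measurable_lpp_vector (X : site -> {RV P >-> R}) (m : nat)
    (u v : 'I_m -> site) : measurable_fun [set: T] (lpp_vector X u v).
Proof.
apply/measurable_fun_tnthP => i.
rewrite (_ : _ \o _ = fun w => lpp (X ^~ w) (u i) (v i)).
  exact: measurable_lpp.
by apply/funext => w /=; rewrite tnth_mktuple.
Qed.

HB.instance Definition _ (X : site -> {RV P >-> R}) (m : nat)
    (u v : 'I_m -> site) :=
  isMeasurableFun.Build _ _ _ _ (lpp_vector X u v)
    (measurable_lpp_vector X u v).

(* The entry of index k = 1, ..., n - 1 is stored at position i = k - 1. *)
Definition point_to_line (X : site -> {RV P >-> R}) (n : nat) :
    {RV P >-> n.-1.-tuple R} :=
  lpp_vector X (fun i : 'I_n.-1 => (1%N, 1%N))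
               (fun i : 'I_n.-1 => ((n - i.+1)%N, i.+1)).

Definition line_to_line (X : site -> {RV P >-> R}) (n : nat) :
    {RV P >-> n.-1.-tuple R} :=
  lpp_vector X (fun i : 'I_n.-1 => ((n - i.+1)%N, 1%N))
               (fun i : 'I_n.-1 => (1%N, i.+1)).

End random_environment.

(* Main.v *)
From mathcomp Require Import all_boot all_order all_algebra finmap.
From mathcomp Require Import zify ring lra.
From mathcomp Require Import all_classical all_reals all_analysis.
From mathcomp Require Import measurable_realfun.
Require Import Defs.

(** Both vectors are the first parts of integer partitions attached to the
antidiagonal of a growth diagram.  Start with weights in [nat].  Attach to each
site a partition (a weakly decreasing sequence of parts) that interlaces with
the partitions of its neighbours, and let a local rule compute the partition
[rho] at the corner of a cell from the other three corners [la] (inner), [mu],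
[nu] and the weight [x] of the cell.  If for fixed [mu] and [nu] the rule is a
bijection between the pairs [(la, x)] and the partitions [rho], and
[x + |mu| + |nu| = |la| + |rho|], then the weights on the staircase correspond
bijectively to the interlacing data on the last two antidiagonals, and these
data determine the sum of the weights.  Two such rules therefore give a
bijection of the weights that preserves their sum and carries the data of one
rule to those of the other.  For the RSK rule the first part at [(i, j)] is the
last passage time from [(1, 1)] to [(i, j)]; for the Burge rule it is the one
from [(i, 1)] to [(1, j)].

For exponential weights, cut space into cubes of side [h].  A cube has a
probability that depends only on the sum of its integer coordinates, so the
bijection preserves probabilities, and letting [h] tend to [0] compares the two
joint distribution functions. *)

Set Implicit Arguments.
Unset Strict Implicit.
Unset Printing Implicit Defensive.

Import Order.TTheory GRing.Theory Num.Theory.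
Import numFieldNormedType.Exports.

Local Open Scope nat_scope.

(** * Growth rules *)

Notation parts := (nat -> nat).

Definition interlaced (a b : parts) := forall k, b k.+1 <= a k <= b k.

(* [F j la mu nu x] is the partition at the site [(i + 1, j + 1)], from [la] at
   [(i, j)], [mu] at [(i, j + 1)], [nu] at [(i + 1, j)] and the weight [x]. *)
Definition growth_rule := nat -> parts -> parts -> parts -> nat -> parts.

(** The vanishing conditions say that [nu] has at most [j] parts and [mu] at most [j + 1].
    Interlacing then leaves [la] at most [j] parts and [rho] at most [j + 1], so sums over [k < N]
    with [j < N] see whole partitions. *)
Record growth_bijection (F : growth_rule) : Prop := {
  growth_interlaced : forall j la mu nu x,
    (forall k, j <= k -> nu k = 0) -> (forall k, j < k -> mu k = 0) ->
    interlaced la mu -> interlaced la nu ->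
    interlaced mu (F j la mu nu x) /\ interlaced nu (F j la mu nu x);
  growth_sum : forall j la mu nu x N,
    (forall k, j <= k -> nu k = 0) -> (forall k, j < k -> mu k = 0) ->
    interlaced la mu -> interlaced la nu -> j < N ->
    \sum_(k < N) F j la mu nu x k + \sum_(k < N) la k =
    x + \sum_(k < N) mu k + \sum_(k < N) nu k;
  growth_inj : forall j la la' mu nu x x',
    (forall k, j <= k -> nu k = 0) -> (forall k, j < k -> mu k = 0) ->
    interlaced la mu -> interlaced la nu ->
    interlaced la' mu -> interlaced la' nu ->
    F j la mu nu x = F j la' mu nu x' -> la = la' /\ x = x';
  growth_surj : forall j mu nu rho,
    (forall k, j <= k -> nu k = 0) -> (forall k, j < k -> mu k = 0) ->
    interlaced mu rho -> interlaced nu rho ->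
    exists la x, [/\ interlaced la mu, interlaced la nu
      & F j la mu nu x = rho] }.

(* [c] is the amount passed from each part to the previous one; both rules are
   of this form, with [c] constant for the RSK rule. *)
Lemma carry_sum (la mu nu rho c : parts) N :
  rho 0 = maxn (mu 0) (nu 0) + c 0 ->
  (forall k, c k + la k + rho k.+1 =
     c k.+1 + minn (mu k) (nu k) + maxn (mu k.+1) (nu k.+1)) ->
  la N = minn (mu N) (nu N) ->
  \sum_(k < N.+1) rho k + \sum_(k < N.+1) la k =
  c N + \sum_(k < N.+1) mu k + \sum_(k < N.+1) nu k.
Proof.
move=> rho0 E; rewrite [\sum_(k < N.+1) la k]big_ord_recr /= addnA => ->.
elim: N => [|N IH]; first by rewrite !big_ord_recr !big_ord0 /= rho0; lia.
move: IH; rewrite [\sum_(k < N.+1) la k]big_ord_recr /=.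
rewrite !(big_ord_recr N.+1) /=; set a := \sum_(k < N.+1) rho k.
set b := \sum_(k < N) la k; set m := \sum_(k < N.+1) mu k.
set n := \sum_(k < N.+1) nu k.
by have := E N; lia.
Qed.

(** For fixed [mu] and [nu], interlacing confines [la k] and the next part of [rho] to the same
    interval, from [maxn (mu k.+1) (nu k.+1)] to [minn (mu k) (nu k)]. The rule reflects this
    interval; the weight only enlarges part 0. *)
Definition rsk_rule : growth_rule := fun _ la mu nu x k =>
  if k is k'.+1 then maxn (mu k) (nu k) + minn (mu k') (nu k') - la k'
  else x + maxn (mu 0) (nu 0).

Lemma rsk_growth_bijection : growth_bijection rsk_rule.
Proof.
split.
- move=> j la mu nu x nu0 mu0 lm ln.
  by split=> k; have := lm k; have := ln k; have := lm k.-1; have := ln k.-1;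
    case: k => [|k] /=; lia.
- move=> j la mu nu x [//|N] nu0 mu0 lm ln jN.
  apply: (carry_sum (c := fun=> x)) => [|k|] /=; first by lia.
    by have := lm k; have := ln k; lia.
  by have := lm N; have := ln N; have := nu0 N jN; lia.
- move=> j la la' mu nu x x' nu0 mu0 lm ln l'm l'n E; split.
    apply/funext => k; have := congr1 (@^~ k.+1) E => /=.
    by have := lm k; have := ln k; have := l'm k; have := l'n k; lia.
  by have := congr1 (@^~ 0) E => /=; lia.
- move=> j mu nu rho nu0 mu0 mr nr.
  exists (fun k => maxn (mu k.+1) (nu k.+1) + minn (mu k) (nu k) - rho k.+1).
  exists (rho 0 - maxn (mu 0) (nu 0)); split.
  + by move=> k; have := mr k; have := nr k;
      have := mr k.+1; have := nr k.+1; lia.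
  + by move=> k; have := mr k; have := nr k;
      have := mr k.+1; have := nr k.+1; lia.
  + apply/funext => -[|k] /=.
      by have := mr 0; have := nr 0; lia.
    by have := mr k; have := nr k; have := mr k.+1; have := nr k.+1; lia.
Qed.

(* The new weight enters at part [j], the last one, and moves up: part [k + 1]
   grows until it hits [la k], and the rest of the weight, together with the
   amount by which [la k] falls short of [minn (mu k) (nu k)], goes on to part
   [k].  The argument [t] counts down from part [j]. *)
Fixpoint burge_carry_rec (j : nat) (la mu nu : parts) (x t : nat) : nat :=
  if t is t'.+1 then
    let c := burge_carry_rec j la mu nu x t' in
    let k := j - t in
    c + minn (mu k) (nu k) + maxn (mu k.+1) (nu k.+1) - la k
      - minn (maxn (mu k.+1) (nu k.+1) + c) (la k)
  else x.

Definition burge_carry j la mu nu x k := burge_carry_rec j la mu nu x (j - k).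

Definition burge_rule : growth_rule := fun j la mu nu x k =>
  let r := maxn (mu k) (nu k) + burge_carry j la mu nu x k in
  if k is k'.+1 then minn r (la k') else r.

Lemma burge_carry_id j la mu nu x k :
  j <= k -> burge_carry j la mu nu x k = x.
Proof. by move=> /eqP jk; rewrite /burge_carry jk. Qed.

(** Below [j] this is the carry recursion with its truncated subtractions undone. From [j] on the
    carry is constantly [x], and [la k], [nu k] and [mu k.+1] vanish. *)
Lemma burge_carryE j la mu nu x :
    (forall k, j <= k -> nu k = 0) -> (forall k, j < k -> mu k = 0) ->
    interlaced la mu -> interlaced la nu ->
  forall k,
  burge_carry j la mu nu x k + la k + burge_rule j la mu nu x k.+1 =
  burge_carry j la mu nu x k.+1 + minn (mu k) (nu k)
    + maxn (mu k.+1) (nu k.+1).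
Proof.
move=> nu0 mu0 lm ln k; rewrite /burge_rule.
have [jk|kj] := leqP j k.
  rewrite !burge_carry_id ?(leq_trans jk) //.
  by have := lm k; have := ln k; have := nu0 k jk; have := mu0 k.+1 jk; lia.
rewrite /burge_carry; have -> : j - k = (j - k.+1).+1 by lia.
rewrite /=; have -> : j - (j - k.+1).+1 = k by lia.
by have := lm k; have := ln k; lia.
Qed.

Lemma burge_growth_bijection : growth_bijection burge_rule.
Proof.
split.
- move=> j la mu nu x nu0 mu0 lm ln; split=> k; have := lm k; have := ln k;
  have := lm k.-1; have := ln k.-1; rewrite /burge_rule;
  case: k => [|k] /=; lia.
- move=> j la mu nu x [//|N] nu0 mu0 lm ln jN.
  rewrite (carry_sum (mu := mu) (nu := nu) (c := burge_carry j la mu nu x))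
    ?(burge_carry_id _ _ _ _ (jN : j <= N)) //.
    by move=> k; have := burge_carryE x nu0 mu0 lm ln k.
  by have := lm N; have := ln N; have := nu0 N jN; lia.
- move=> j la la' mu nu x x' nu0 mu0 lm ln l'm l'n E.
  have cE := burge_carryE x nu0 mu0 lm ln.
  have c'E := burge_carryE x' nu0 mu0 l'm l'n.
  have cc k : burge_carry j la mu nu x k = burge_carry j la' mu nu x' k /\
              (forall i, i < k -> la i = la' i).
    elim: k => [|k [IH IHla]].
      by split => //; have := congr1 (@^~ 0) E; rewrite /burge_rule; lia.
    have := cE k; have := c'E k; have := congr1 (@^~ k.+1) E.
    rewrite -IH /burge_rule => {}E E1 E2.
    have lk : la k = la' k.
      by have := lm k; have := ln k; have := l'm k; have := l'n k; lia.
    split; first by lia.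
    by move=> i; rewrite ltnS leq_eqVlt => /predU1P[-> //|/IHla].
  split; first by apply/funext => k; apply: (cc k.+1).2.
  by have := (cc j).1; rewrite !burge_carry_id.
- move=> j mu nu rho nu0 mu0 mr nr.
  (* The inverse runs from part 0 to part [j]. If part [k + 1] stopped at [la k], then
     [rho k.+1 = la k] and [la k >= m k - c k]. Otherwise it absorbed the whole carry and only the
     shortfall went on, so [la k = m k - c k >= rho k.+1]. In both cases [la k] is the maximum of
     the two. *)
  pose M k := maxn (mu k) (nu k); pose m k := minn (mu k) (nu k).
  pose c := fix c k := if k is k'.+1 then
    c k' + maxn (m k' - c k') (rho k) + rho k - m k' - M k
    else rho 0 - M 0.
  pose la k := maxn (m k - c k) (rho k.+1).
  have cS k : c k.+1 = c k + la k + rho k.+1 - m k - M k.+1 by [].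
  have lm : interlaced la mu.
    move=> k; have := mr k; have := nr k; have := mr k.+1.
    by rewrite /la /m; lia.
  have ln : interlaced la nu.
    move=> k; have := mr k; have := nr k; have := nr k.+1.
    by rewrite /la /m; lia.
  exists la, (c j); split=> //.
  have cst k : j <= k -> c k = c j.
    move=> jk; rewrite -(subnKC jk); elim: (k - j) => [|i IH].
      by rewrite addn0.
    rewrite addnS cS IH /la /m /M; have := nu0 (j + i); have := mr (j + i).
    have := nr (j + i); have := mu0 (j + i).+1; have := nu0 (j + i).+1.
    by lia.
  have cE k : burge_carry j la mu nu (c j) k = c k.
    have [jk|kj] := leqP j k; first by rewrite burge_carry_id ?cst.
    rewrite /burge_carry -{2}(subKn (ltnW kj)).
    elim: (j - k) (leq_subr k j) => [_|t IH tj]; first by rewrite subn0.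
    rewrite /= IH ?(ltnW tj) //; have -> : j - t = (j - t.+1).+1 by lia.
    move: (j - t.+1) => i; rewrite cS /la /M /m.
    have := mr i; have := nr i; have := mr i.+1; have := nr i.+1.
    by lia.
  apply/funext => -[|k]; rewrite /burge_rule cE.
    by have := mr 0; have := nr 0; rewrite /= /M; lia.
  rewrite cS /la /M /m; have := mr k; have := nr k; have := mr k.+1.
  by have := nr k.+1; lia.
Qed.

(** * Growth diagrams *)

Fixpoint growth (F : growth_rule) (x : nat -> nat -> nat) (i : nat) :
    nat -> parts :=
  if i is i'.+1 then
    fix row j := if j is j'.+1
      then F j' (growth F x i' j') (growth F x i' j) (row j') (x i' j')
      else fun=> 0
  else fun _ _ => 0.

Lemma growthS F x i j : growth F x i.+1 j.+1 =
  F j (growth F x i j) (growth F x i j.+1) (growth F x i.+1 j) (x i j).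
Proof. by []. Qed.

Lemma growth0l F x j : growth F x 0 j = fun=> 0. Proof. by []. Qed.

Lemma growth0r F x i : growth F x i 0 = fun=> 0. Proof. by case: i. Qed.

Lemma eq_growth F x y i j :
    (forall a b, a < i -> b < j -> x a b = y a b) ->
  growth F x i j = growth F y i j.
Proof.
elim: i j => [|i IHi] j xy; first by rewrite !growth0l.
elim: j xy => [|j IHj] xy; first by rewrite !growth0r.
rewrite !growthS (IHi j) ?(IHi j.+1) ?IHj ?xy // => a b ai bj; apply: xy; lia.
Qed.

Definition diagonal_data (d : nat) (S : nat -> nat -> parts) :=
  (forall i j k, d <= i + j <= d.+1 -> minn i j <= k -> S i j k = 0) /\
  (forall i j, i + j = d ->
     interlaced (S i j) (S i j.+1) /\ interlaced (S i j) (S i.+1 j)).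

Section growth_bijection.
Variables (F : growth_rule) (HF : growth_bijection F).

Lemma growth_diagonal_data x d : diagonal_data d (growth F x).
Proof.
(* Vanishing on antidiagonal [d + 1] follows from that on [d]: part [k + 1] at a site is at most
   part [k] at each preceding neighbour. *)
suff [A B] : (forall i j k, i + j = d -> minn i j <= k -> growth F x i j k = 0)
   /\ (forall i j, i + j = d ->
     interlaced (growth F x i j) (growth F x i j.+1) /\
     interlaced (growth F x i j) (growth F x i.+1 j)).
  split=> // -[|i] [|j] k // ijd kij; rewrite ?growth0r //.
  have [E|ijd'] := eqVneq (i + j).+2 d; first by apply: A => //; lia.
  case: k kij => [|k] kij; first by lia.
  have ijl : i + j.+1 = d by lia.
  have ijr : i.+1 + j = d by lia.
  have := (B _ _ ijl).2 k; have := A _ _ k ijl.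
  have := (B _ _ ijr).1 k; have := A _ _ k ijr.
  by lia.
elim: d => [|d [IHA IHB]].
  split=> [[|i] [|j] k|[|i] [|j]] //=.
have A : forall i j k, i + j = d.+1 -> minn i j <= k -> growth F x i j k = 0.
  move=> [|i] [|j] [|k] // ijd kij; rewrite ?growth0r //; first by lia.
  have ijl : i + j.+1 = d by lia.
  have ijr : i.+1 + j = d by lia.
  have := (IHB _ _ ijl).2 k; have := IHA _ _ k ijl.
  have := (IHB _ _ ijr).1 k; have := IHA _ _ k ijr.
  by lia.
split=> // i j ijd; split.
  case: i ijd => [|i] ijd; first by rewrite !growth0l.
  rewrite growthS; have [|??] := IHB i j; first by lia.
  by apply: (growth_interlaced HF _ _ _ _ _).2 => // k kj; apply: A; lia.
case: j ijd => [|j] ijd; first by rewrite !growth0r.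
rewrite growthS; have [|??] := IHB i j; first by lia.
by apply: (growth_interlaced HF _ _ _ _ _).1 => // k kj; apply: A; lia.
Qed.

Lemma growth_zero x i j k : minn i j <= k -> growth F x i j k = 0.
Proof.
move=> ijk; apply: (growth_diagonal_data x (i + j)).1 => //.
by rewrite leqnn leqnSn.
Qed.

Lemma growth_interlacedl x i j :
  interlaced (growth F x i j) (growth F x i.+1 j).
Proof. by have [_ /(_ i j erefl)[]] := growth_diagonal_data x (i + j). Qed.

Lemma growth_interlacedr x i j :
  interlaced (growth F x i j) (growth F x i j.+1).
Proof. by have [_ /(_ i j erefl)[]] := growth_diagonal_data x (i + j). Qed.

(** [growth_surj] undoes the cells between the outer antidiagonal and the one two steps inside. This
    yields the weights of these cells and diagonal data one step further in, and induction
    applies. *)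
Lemma growth_diagonal_onto d S : diagonal_data d S ->
  exists x, forall i j, d <= i + j <= d.+1 -> growth F x i j = S i j.
Proof.
elim: d S => [|d IH] S [S0 Sint].
  exists (fun _ _ => 0) => -[|[|i]] [|[|j]] //= ij;
  by apply/esym/funext => k; apply: S0.
have /choice[f fP] : forall i, exists p : parts * nat, i <= d ->
    [/\ interlaced p.1 (S i (d - i).+1), interlaced p.1 (S i.+1 (d - i))
      & F (d - i) p.1 (S i (d - i).+1) (S i.+1 (d - i)) p.2 =
        S i.+1 (d - i).+1].
  move=> i; have [id|_] := leqP i d; last by exists (fun=> 0, 0).
  have [||||la [x [? ? ?]]] := growth_surj HF (j := d - i)
      (mu := S i (d - i).+1) (nu := S i.+1 (d - i))
      (rho := S i.+1 (d - i).+1).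
  - by move=> k ?; apply: S0; lia.
  - by move=> k ?; apply: S0; lia.
  - by apply: (Sint _ _ _).2; lia.
  - by apply: (Sint _ _ _).1; lia.
  by exists (la, x).
have fS i j : i + j = d -> [/\ interlaced (f i).1 (S i j.+1),
    interlaced (f i).1 (S i.+1 j)
    & F j (f i).1 (S i j.+1) (S i.+1 j) (f i).2 = S i.+1 j.+1].
  move=> ijd; have -> : j = d - i by lia.
  by apply: fP; lia.
have [|y yP] := IH (fun i j => if i + j == d then (f i).1 else S i j).
  split=> [i j k ij kij|i j ijd]; last first.
    by rewrite ijd eqxx !(addSn, addnS) ijd !gtn_eqF //; case: (fS i j ijd).
  have [ijd|nijd] := eqVneq (i + j) d; last by apply: S0; lia.
  have [il ir _] := fS i j ijd; have := il k; have := ir k.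
  have [ki|kj] := leqP i k.
    by rewrite (S0 i j.+1 k); lia.
  by rewrite (S0 i.+1 j k); lia.
exists (fun i j => if i + j == d then (f i).2 else y i j) => i j ijd.
(* A partition at [(a, b)] sees only weights with index sum at most [a + b - 2], so the new weights
   on antidiagonal [d] do not reach it. *)
have low a b : a + b <= d.+1 ->
    growth F (fun i j => if i + j == d then (f i).2 else y i j) a b =
    growth F y a b.
  by move=> abd; apply: eq_growth => a' b' ? ?; rewrite ltn_eqF //; lia.
have [ijE|nijd] := eqVneq (i + j) d.+1.
  by rewrite low ?ijE // yP ?ijE ?leqnn ?leqnSn // gtn_eqF.
case: i j ijd nijd => [|i] [|j] ijd nijd; rewrite ?growth0l ?growth0r;
  try by apply/esym/funext => k; apply: S0; lia.
have ijE : i + j = d by lia.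
rewrite growthS !low ?ijE ?eqxx; try lia.
rewrite !yP ?ijE; try lia.
by rewrite eqxx !(addSn, addnS) ijE !gtn_eqF //; case: (fS i j ijE).
Qed.

Lemma growth_diagonal_inj d x y :
    (forall i j, d <= i + j <= d.+1 -> growth F x i j = growth F y i j) ->
  forall i j, i + j < d -> x i j = y i j.
Proof.
elim: d => // d IH xy.
have step i j : i + j = d ->
    growth F x i j = growth F y i j /\ x i j = y i j.
  move=> ijd.
  have := xy i.+1 j.+1; rewrite !growthS (xy i j.+1) ?(xy i.+1 j); try lia.
  move=> E.
  have El := growth_interlacedl x i j; have Er := growth_interlacedr x i j.
  rewrite (xy i.+1 j) in El; last by lia.
  rewrite (xy i j.+1) in Er; last by lia.
  apply: (growth_inj HF _ _ Er El _ _ (E _)).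
  - by move=> k kj; apply: growth_zero; lia.
  - by move=> k kj; apply: growth_zero; lia.
  - exact: growth_interlacedr.
  - exact: growth_interlacedl.
  - by lia.
move=> i j ijd; have [E|N] := eqVneq (i + j) d; first exact: (step i j E).2.
apply: IH; last by lia.
move=> a b abd; have [E|N'] := eqVneq (a + b) d; first exact: (step a b E).1.
by apply: xy; lia.
Qed.

(** Let [D e] be the total size on antidiagonal [e]. In [growth_sum] added over one antidiagonal of
    cells, the middle partitions occur once as [mu] and once as [nu]; hence [D d.+2 - D d.+1]
    exceeds [D d.+1 - D d] by the weights of these cells, and the differences add up. *)
Lemma growth_diagonal_sum x d N : d <= N ->
  \sum_(i < d.+2) \sum_(k < N) growth F x i (d.+1 - i) k =
  \sum_(i < d.+1) \sum_(k < N) growth F x i (d - i) k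
  + \sum_(e < d) \sum_(i < e.+1) x i (e - i).
Proof.
pose s i j := \sum_(k < N) growth F x i j k.
pose D e := \sum_(i < e.+1) s i (e - i).
have sl j : s 0 j = 0 by apply: big1.
have sr i : s i 0 = 0 by apply: big1 => k _; rewrite growth0r.
have Dl e : \sum_(i < e.+1) s i (e.+1 - i) = D e.+1.
  by rewrite /D [RHS]big_ord_recr /= subnn sr addn0.
have Dr e : \sum_(i < e.+1) s i.+1 (e - i) = D e.+1.
  by rewrite /D [RHS]big_ord_recl /= sl add0n.
have Dlr e : \sum_(i < e.+1) s i.+1 (e.+1 - i) = D e.+2.
  by rewrite -(Dl e.+1) [RHS]big_ord_recl /= sl add0n.
rewrite -/(D d.+1) -/(D d); elim: d => [|d IH] dN.
  by rewrite /D !big_ord_recr !big_ord0 /= !sl !sr.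
have step (i : 'I_d.+1) : s i.+1 (d.+1 - i) + s i (d - i) =
    x i (d - i) + s i (d.+1 - i) + s i.+1 (d - i).
  have id : i <= d by rewrite -ltnS.
  rewrite subSn // /s growthS; apply: (growth_sum HF).
  - by move=> k kj; apply: growth_zero; lia.
  - by move=> k kj; apply: growth_zero; lia.
  - exact: growth_interlacedr.
  - exact: growth_interlacedl.
  - by lia.
rewrite big_ord_recr /=.
have := eq_bigr (P := xpredT) (r := index_enum _) (op := addn) (idx := 0)
  _ (fun i _ => step i).
rewrite !big_split /= Dl Dr Dlr -/(D d).
have := IH (ltnW dN); move: (D _) (D _) (D _) => a b c.
by move: (\sum_(i < d) _) (\sum_(i < d.+1) _) => u v; lia.
Qed.

End growth_bijection.

(** * First parts of Burge diagrams *)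

(* If [f i] is the last passage time from column [i] (numbered from 1, so of
   weight [r i.-1]) to column 1 through some rows, [add_row r f] is the one
   through these rows and one more in front, of weights [r].  Since the
   weights are nonnegative, [fun=> 0] may stand for the empty set of rows. *)
Fixpoint add_row (r f : nat -> nat) (i : nat) : nat :=
  if i is i'.+1 then r i' + maxn (f i) (add_row r f i') else 0.

Lemma add_rowS r f i :
  add_row r f i.+1 = r i + maxn (f i.+1) (add_row r f i).
Proof. by []. Qed.

Fixpoint add_rows (rs : nat -> nat -> nat) (j : nat) (f : nat -> nat) :
    nat -> nat :=
  if j is j'.+1 then add_rows rs j' (add_row (rs j') f) else f.

Lemma add_rowsSl rs j f :
  add_rows rs j.+1 f = add_row (rs 0) (add_rows (fun k => rs k.+1) j f).
Proof. by elim: j f => // j IH f; exact: IH. Qed.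

(* Two rows may be replaced by the output of a queue: [d] is the queue length,
   [b] the arrivals, [a] the services and [a'] the departures. *)
Lemma add_row_exchange (a b a' b' d f : nat -> nat) : d 0 = 0 ->
    (forall i, a' i = minn (a i) (d i)) ->
    (forall i, a' i + b' i = a i + b i) ->
    (forall i, d i.+1 + a' i = d i + b i) ->
  add_row b (add_row a f) = add_row b' (add_row a' f).
Proof.
move=> d0 a'E b'E dS; apply/funext => i.
set g := add_row a f; set g' := add_row a' f.
set h := add_row b g; set h' := add_row b' g'.
(* The equality of [h] and [h'] does not propagate alone. The invariant adds two inequalities on
   [g'] and [h], of which at least one is always tight. *)
suff [] : [/\ h i = h' i, g' i <= g i, h i <= g i + d i
             & g' i = g i \/ h i = g i + d i] by [].
elim: i => [|i [hh' g'g hgd alt]]; first by split=> //; left.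
have := a'E i; have := b'E i; have := dS i.
have -> : h i.+1 = b i + maxn (g i.+1) (h i) by [].
have -> : h' i.+1 = b' i + maxn (g' i.+1) (h' i) by [].
have -> : g i.+1 = a i + maxn (f i.+1) (g i) by [].
have -> : g' i.+1 = a' i + maxn (f i.+1) (g' i) by [].
rewrite -hh'; move: (f i.+1) (g i) (g' i) (h i) hgd g'g alt.
move=> fi gi g'i hi hgd g'g alt dSi b'i a'i.
by split; lia.
Qed.

Lemma rsk_growth0 x i j :
  growth rsk_rule x i.+1 j.+1 0 =
  x i j + maxn (growth rsk_rule x i j.+1 0) (growth rsk_rule x i.+1 j 0).
Proof. by []. Qed.

Section burge.
Variable x : nat -> nat -> nat.
Local Notation G := (growth burge_rule x).

Let Gl := growth_interlacedl burge_growth_bijection x.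
Let Gr := growth_interlacedr burge_growth_bijection x.
Let G0 := growth_zero burge_growth_bijection x.

(* Adding row [j] at the bottom amounts to exchanging it successively with the
   rows [burge_row j k], for [k] from [j - 1] down to [0]; [burge_bumped j k] is
   the row in transit just after row [k] has been passed. *)
Definition burge_row j k i := G i.+1 j k - G i j k.

Definition burge_bumped j k i :=
  burge_carry j (G i j) (G i j.+1) (G i.+1 j) (x i j) k
  + (G i.+1 j k - G i j.+1 k).

Lemma burge_bump j k i :
  [/\ burge_row j.+1 k.+1 i =
        minn (burge_bumped j k.+1 i) (G i j k - G i j.+1 k.+1),
      burge_row j.+1 k.+1 i + burge_bumped j k i =
        burge_bumped j k.+1 i + burge_row j k i
    & G i.+1 j k - G i.+1 j.+1 k.+1 + burge_row j.+1 k.+1 i =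
        G i j k - G i j.+1 k.+1 + burge_row j k i].
Proof.
have nu0 k' : j <= k' -> G i.+1 j k' = 0 by move=> ?; apply: G0; lia.
have mu0 k' : j < k' -> G i j.+1 k' = 0 by move=> ?; apply: G0; lia.
have := burge_carryE (x i j) nu0 mu0 (Gr i j) (Gl i j) k.
rewrite -growthS.
have : G i.+1 j.+1 k.+1 = minn (maxn (G i j.+1 k.+1) (G i.+1 j k.+1)
  + burge_carry j (G i j) (G i j.+1) (G i.+1 j) (x i j) k.+1) (G i j k) by [].
rewrite /burge_row /burge_bumped.
move: (burge_carry _ _ _ _ _ k) (burge_carry _ _ _ _ _ k.+1) => c c'.
have := Gr i j k; have := Gl i j k; have := Gr i.+1 j k; have := Gl i j.+1 k.
have := Gr i j k.+1; have := Gl i j k.+1; have := Gl i j.+1 k.+1.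
by split; lia.
Qed.

Lemma burge_bumped0 j i : burge_bumped j 0 i = burge_row j.+1 0 i.
Proof.
rewrite /burge_bumped /burge_row.
have -> : G i.+1 j.+1 0 = maxn (G i j.+1 0) (G i.+1 j 0)
  + burge_carry j (G i j) (G i j.+1) (G i.+1 j) (x i j) 0 by [].
lia.
Qed.

Lemma burge_bumped_id j i : burge_bumped j j i = x i j.
Proof.
by rewrite /burge_bumped burge_carry_id // (G0 (k := j)) ?geq_minr // addn0.
Qed.

Lemma burge_insert j k f :
  add_rows (burge_row j) k (add_row (burge_bumped j k) f) =
  add_rows (burge_row j.+1) k.+1 f.
Proof.
elim: k f => [|k IH] f /=.
  by congr add_row; apply/funext => i; exact: burge_bumped0.
rewrite (@add_row_exchange _ _ (burge_row j.+1 k.+1) (burge_bumped j k)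
  (fun i => G i j k - G i j.+1 k.+1)) ?IH //.
- by move=> i; case: (burge_bump j k i).
- by move=> i; case: (burge_bump j k i).
- by move=> i; case: (burge_bump j k i).
Qed.

Lemma burge_growth_rows j f :
  add_rows (fun j i => x i j) j f = add_rows (burge_row j) j f.
Proof.
elim: j f => // j IH f; rewrite -burge_insert /= IH.
by congr (add_rows _ _ (add_row _ _)); apply/funext => i;
  rewrite burge_bumped_id.
Qed.

(** On the rows [burge_row j] the maximum in [add_row] is resolved by interlacing,
    [G i.+1 j k.+1 <= G i j k]. The increments telescope, and adding row [k] turns part [k + 1] into
    part [k]; start from part [j], which is zero. *)
Lemma burge_growth0 i j :
  G i j 0 = add_rows (fun j i => x i j) j (fun=> 0) i.
Proof.
rewrite burge_growth_rows.
suff H k : k <= j -> add_rows (burge_row j) k (G ^~ j ^~ k) = G ^~ j ^~ 0.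
  rewrite -[LHS]/((G ^~ j ^~ 0) i) -(H j) //; congr (add_rows _ _ _ _).
  by apply/funext => i'; rewrite G0 ?geq_minr.
elim: k => // k IH kj; rewrite /= -(IH (ltnW kj)); congr add_rows.
apply/funext; elim=> [|i' IHi]; first by [].
rewrite add_rowS IHi /burge_row.
by have := Gl i' j k; lia.
Qed.

End burge.

(** * Weights on a staircase *)

Definition staircase_seq (d : nat) : seq site :=
  [seq (i.+1, (e - i).+1) | e <- iota 0 d, i <- iota 0 e.+1].

Lemma mem_staircase_seq d s :
  (s \in staircase_seq d) = quadrant s && (s.1 + s.2 <= d.+1).
Proof.
apply/allpairsPdep/idP => [[e [i [+ + ->]]]|].
  by rewrite !mem_iota /quadrant /=; lia.
case: s => [[|a] [|b]]; rewrite /quadrant //= => abd.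
exists (a + b), a; split; last by rewrite addKn.
  by rewrite mem_iota; lia.
by rewrite -[_ :: _]/(iota 0 (a + b).+1) mem_iota; lia.
Qed.

Lemma staircase_seq_uniq d : uniq (staircase_seq d).
Proof.
apply: allpairs_uniq_dep => [|e _|]; rewrite ?iota_uniq //.
move=> [e i] [e' i'] /allpairsPdep[a [b [_ + [-> ->]]]].
move=> + /allpairsPdep[a' [b' [_ + [-> ->]]]] /= [].
rewrite !mem_iota => /andP[_ ba] /andP[_ ba'] bb' ab; subst b'.
by rewrite (_ : a' = a) //; move: a a' ba ba' ab => /= a a'; lia.
Qed.

Definition staircase (d : nat) : {fset site} :=
  [fset s in staircase_seq d]%fset.

Lemma mem_staircase d s :
  (s \in staircase d) = quadrant s && (s.1 + s.2 <= d.+1).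
Proof. by rewrite inE /= mem_staircase_seq. Qed.

Definition staircase_sum (d : nat) (x : nat -> nat -> nat) :=
  \sum_(e < d) \sum_(i < e.+1) x i (e - i).

Lemma staircase_sumE d x :
  \sum_(s <- staircase d) x s.1.-1 s.2.-1 = staircase_sum d x.
Proof.
rewrite (perm_big (staircase_seq d)) /=; last first.
  apply: uniq_perm => [||s]; [exact: fset_uniq|exact: staircase_seq_uniq|].
  by rewrite !inE.
rewrite big_allpairs_dep /staircase_sum.
rewrite -(big_mkord xpredT (fun e => \sum_(i < e.+1) x i (e - i))).
rewrite /index_iota subn0.
apply: eq_bigr => e _.
by rewrite -(big_mkord xpredT (fun i => x i (e - i))) /index_iota subn0.
Qed.

Lemma leq_staircase_sum d x i j : i + j < d -> x i j <= staircase_sum d x.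
Proof.
move=> ijd; rewrite -staircase_sumE (big_fsetD1 (i.+1, j.+1)) /= ?leq_addr //.
by rewrite mem_staircase /quadrant /=; lia.
Qed.

Lemma eq_staircase_sum d x y : (forall i j, i + j < d -> x i j = y i j) ->
  staircase_sum d x = staircase_sum d y.
Proof.
move=> xy; apply: eq_bigr => e _; apply: eq_bigr => i _; apply: xy.
by rewrite subnKC; [exact: ltn_ord|rewrite -ltnS].
Qed.

(** * Transfer of bounded weights between two growth rules *)

Section growth_pair.
Variables (d : nat).

Lemma eq_growth_staircase F x y i j : i + j <= d.+1 ->
  (forall i j, i + j < d -> x i j = y i j) ->
  growth F x i j = growth F y i j.
Proof. by move=> ijd xy; apply: eq_growth => a b ? ?; apply: xy; lia. Qed.

(** The weights sum to at most the total size on antidiagonal [d + 1], which has [d + 2] sites with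
    [d] parts each, every part being at most the first one. The two sites on the axes carry empty
    partitions. *)
Lemma staircase_sum_bound F (HF : growth_bijection F) x K :
    (forall k, k < d -> growth F x (d - k) k.+1 0 <= K) ->
  staircase_sum d x <= d.+2 * (d * K).
Proof.
move=> GK; have := growth_diagonal_sum HF x (leqnn d).
rewrite -/(staircase_sum d x) => E.
apply: leq_trans
  (_ : _ <= \sum_(i < d.+2) \sum_(k < d) growth F x i (d.+1 - i) k) _.
  by rewrite E leq_addl.
rewrite -[d.+2 in leqRHS]card_ord -sum_nat_const leq_sum // => i _.
rewrite -[d in leqRHS]card_ord -sum_nat_const leq_sum // => k _.
have mono k' : growth F x i (d.+1 - i) k' <= growth F x i (d.+1 - i) 0.
  elim: k' => // k' IH; apply: leq_trans IH; case: (nat_of_ord i) => // i'.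
  have := growth_interlacedl HF x i' (d.+1 - i'.+1) k'.
  by move=> /andP[/leq_trans]; apply.
apply: leq_trans (mono k) _; case: i {mono} => i /=; case: i => [|i] ilt.
  by rewrite growth0l.
rewrite subSS; have [->|id] := eqVneq i d; first by rewrite subnn growth0r.
have id' : d - i.+1 < d by lia.
have := GK _ id'; rewrite subKn; last by lia.
by rewrite -subSn ?subSS //; lia.
Qed.

Lemma growth_transfer F G x : growth_bijection F -> growth_bijection G ->
  exists y, (forall i j, d <= i + j <= d.+1 -> growth G y i j = growth F x i j)
    /\ staircase_sum d y = staircase_sum d x.
Proof.
move=> HF HG.
have [y yE] := growth_diagonal_onto HG (growth_diagonal_data HF x d).
exists y; split=> //.
have := growth_diagonal_sum HG y (leqnn d).
have := growth_diagonal_sum HF x (leqnn d).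
rewrite -!/(staircase_sum d _).
have D e : d <= e <= d.+1 ->
    \sum_(i < e.+1) \sum_(k < d) growth G y i (e - i) k =
    \sum_(i < e.+1) \sum_(k < d) growth F x i (e - i) k.
  move=> ed; apply: eq_bigr => i _; apply: eq_bigr => k _.
  by rewrite yE // subnKC // -ltnS.
rewrite (D d) ?leqnn ?leqnSn // (D d.+1) ?leqnn ?leqnSn // => -> /addnI.
by [].
Qed.

Section bounded_arrays.
Variable B : nat.

Definition array := {ffun staircase d -> 'I_B.+1}.

Definition array_ext (x : array) (i j : nat) : nat :=
  if insub (i.+1, j.+1) is Some s then x s else 0.

Definition array_res (y : nat -> nat -> nat) : array :=
  [ffun s => inord (y (val s).1.-1 (val s).2.-1)].

Lemma array_resK y : staircase_sum d y <= B ->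
  forall i j, i + j < d -> array_ext (array_res y) i j = y i j.
Proof.
move=> yB i j ijd; rewrite /array_ext insubT ?mem_staircase /quadrant /=.
  by lia.
move=> ijJ; rewrite ffunE /= inordK // ltnS (leq_trans _ yB) //.
exact: leq_staircase_sum.
Qed.

Lemma array_ext_inj x y :
  (forall i j, i + j < d -> array_ext x i j = array_ext y i j) -> x = y.
Proof.
move=> xy; apply/ffunP => s; apply/val_inj.
have := valP s; rewrite mem_staircase => /andP[/andP[s1 s2] sd].
have sd' : (val s).1.-1 + (val s).2.-1 < d.
  by move: s1 s2 sd; case: (val s) => a b /=; lia.
have := xy _ _ sd'.
by rewrite /array_ext !prednK // -surjective_pairing valK.
Qed.

Variables (R : realType) (h : R) (t : 'I_d -> R).

(** The bound is on the sum because the transfer between two rules preserves the sum; it makes the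
    transferred weights fit into ['I_B.+1]. *)
Definition small_arrays (F : growth_rule) : {set array} :=
  [set x | (staircase_sum d (array_ext x) <= B)%N && [forall k : 'I_d,
    h * (growth F (array_ext x) (d - k)%N k.+1 0)%:R <= t k]]%R.

(** [growth_transfer] injects the small arrays of [F] into those of [G] without changing the sum.
    Since [w] is nonnegative, the terms outside the image can only help. *)
Lemma small_arrays_sum_le F G (w : nat -> R) :
    growth_bijection F -> growth_bijection G -> (forall k, 0 <= w k)%R ->
  (\sum_(x in small_arrays F) w (staircase_sum d (array_ext x)) <=
   \sum_(x in small_arrays G) w (staircase_sum d (array_ext x)))%R.
Proof.
move=> HF HG w0.
have /choice[f fP] x := growth_transfer (array_ext x) HF HG.
pose th x := array_res (f x).
have thE x : x \in small_arrays F ->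
    (forall i j, i + j < d -> array_ext (th x) i j = f x i j).
  rewrite inE => /andP[xB _]; apply: array_resK.
  by case: (fP x) => _ ->.
have thG x : x \in small_arrays F -> forall i j, d <= i + j <= d.+1 ->
    growth G (array_ext (th x)) i j = growth F (array_ext x) i j.
  move=> xA i j /[dup] /andP[_ ijd] /(proj1 (fP x)) <-.
  by apply: eq_growth_staircase => // *; exact: thE.
have thS x : x \in small_arrays F ->
    staircase_sum d (array_ext (th x)) = staircase_sum d (array_ext x).
  by move=> xA; rewrite (eq_staircase_sum (thE x xA)) (proj2 (fP x)).
have th_inj : {in small_arrays F &, injective th}.
  move=> x y xA yA xy; apply: array_ext_inj.
  apply: (growth_diagonal_inj HF) => i j ijd.
  by rewrite -thG // xy thG.
under eq_bigr => x xA do rewrite -thS //.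
rewrite -(big_imset (fun x => w (staircase_sum d (array_ext x))) th_inj) /=.
rewrite [leRHS](finset.big_setID (th @: small_arrays F)) /=.
rewrite (finset.setIidPr _) ?lerDl ?sumr_ge0 //.
apply/fintype.subsetP => _ /imsetP[x xA ->]; rewrite inE thS //.
have := xA; rewrite inE => /andP[-> /forallP xt] /=.
apply/forallP => k; rewrite thG ?xt //; have := ltn_ord k; lia.
Qed.

End bounded_arrays.
End growth_pair.

Local Open Scope classical_set_scope.
Local Open Scope ring_scope.

(** * Last passage times *)

Lemma dist1C u v : dist1 u v = dist1 v u.
Proof. by rewrite /dist1; lia. Qed.

Lemma dist1_triangle w u v : (dist1 u v <= dist1 u w + dist1 w v)%N.
Proof. by rewrite /dist1; lia. Qed.

Lemma dist1_path u p : path adjacent u p -> (dist1 u (last u p) <= size p)%N.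
Proof.
elim: p u => [|w p IH] u /=; first by rewrite /dist1; lia.
move=> /andP[/eqP uw /IH wp].
by have := dist1_triangle w u (last w p); lia.
Qed.

Lemma lattice_path_cons u v w p : quadrant u -> adjacent u w ->
  dist1 u v = (dist1 w v).+1 -> lattice_path w v p ->
  lattice_path u v (w :: p).
Proof.
move=> qu uw duv /and4P[qp wp lp /eqP sp].
by apply/and4P; split => //=; rewrite ?qu ?uw ?sp ?duv.
Qed.

Lemma lattice_path_consP u v w p : lattice_path u v (w :: p) ->
  [/\ quadrant u, adjacent u w, dist1 u v = (dist1 w v).+1
    & lattice_path w v p].
Proof.
move=> /and4P[/andP[qu qp] /= /andP[uw wp] /eqP lp /eqP sp].
have := dist1_path wp; have := dist1_triangle w u v.
rewrite lp (eqP uw) => h1 h2.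
split=> //; first by lia.
by apply/and4P; split; rewrite ?lp //; apply/eqP; lia.
Qed.

Lemma lattice_path_rev u v p : lattice_path u v p ->
  lattice_path v u (rev (belast u p)).
Proof.
move=> /and4P[qp up /eqP lp /eqP sp].
have E : v :: rev (belast u p) = rev (u :: p).
  by rewrite [in RHS]lastI rev_rcons lp.
apply/and4P; split.
- by rewrite E all_rev.
- have := rev_path adjacent u p; rewrite lp => ->.
  rewrite (eq_path (e' := adjacent)) // => a b.
  by rewrite /adjacent dist1C.
- case: p {qp up sp} lp E => [/= ->//|w p] lp E.
  by rewrite /= rev_cons last_rcons.
- by rewrite size_rev size_belast sp dist1C.
Qed.

Lemma lattice_path_box u v p s : lattice_path u v p -> s \in u :: p ->
  [/\ quadrant s, (s.1 <= maxn u.1 v.1)%N & (s.2 <= maxn u.2 v.2)%N].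
Proof.
move=> lp sp; have /and4P[/allP/(_ _ sp) qs _ _ _] := lp.
suff : (dist1 u s + dist1 s v <= dist1 u v)%N.
  move=> dsv; split=> //; move: dsv {qs lp sp}; rewrite /dist1.
    by case: s u v => [s1 s2] [u1 u2] [v1 v2] /=; lia.
  by case: s u v => [s1 s2] [u1 u2] [v1 v2] /=; lia.
elim: p u lp sp => [|w p IH] u lp.
  by rewrite mem_seq1 => /eqP ->; rewrite /dist1; lia.
rewrite in_cons => /orP[/eqP ->|sp]; first by rewrite /dist1; lia.
have [qu /eqP uw -> lwp] := lattice_path_consP lp.
by have := IH w lwp sp; have := dist1_triangle w u s; lia.
Qed.

Section lpp.
Context {R : realType}.
Implicit Types (x y : site -> R) (u v w : site).

Lemma lpp_sym x u v : quadrant u -> quadrant v -> lpp x u v = lpp x v u.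
Proof.
move=> qu qv.
wlog suff H : u v qu qv / lpp x u v <= lpp x v u.
  by apply/le_anti; rewrite !H.
have [[p lp ->] _] := lpp_max x qu qv; have [_ M] := lpp_max x qv qu.
have /and4P[_ _ /eqP lpE _] := lp.
apply: le_trans (M _ (lattice_path_rev lp)).
rewrite [u :: p]lastI lpE -rev_rcons.
by rewrite (perm_big _ (permEl (perm_rev _))).
Qed.

(** Dynamic programming towards [v]: the inequality bounds all path sums by induction on the path,
    and the equality case builds an optimal path step by step. [D] is a region that steps towards
    [v] do not leave. *)
Lemma lpp_recursion x (L : site -> R) (D : pred site) v : quadrant v ->
    (forall u, D u -> quadrant u) -> L v = x v ->
    (forall u w, D u -> adjacent u w -> quadrant w ->
       dist1 u v = (dist1 w v).+1 -> D w /\ x u + L w <= L u) ->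
    (forall u, D u -> u != v -> exists w, [/\ adjacent u w, quadrant w,
       dist1 u v = (dist1 w v).+1 & L u = x u + L w]) ->
  forall u, D u -> lpp x u v = L u.
Proof.
move=> qv Dq Lv ub att.
have le_L p u : D u -> lattice_path u v p -> \sum_(s <- u :: p) x s <= L u.
  elim: p u => [|w p IH] u Du lp.
    by have /and4P[_ _ /eqP/= -> _] := lp; rewrite big_seq1 Lv.
  have [_ uw duv lwp] := lattice_path_consP lp.
  have qw : quadrant w by case/and4P: lwp => /andP[].
  have [Dw] := ub u w Du uw qw duv; apply: le_trans.
  by rewrite big_cons lerD2l IH.
have ex_L u : D u -> exists2 p, lattice_path u v p &
    \sum_(s <- u :: p) x s = L u.
  move em : (dist1 u v) => m; elim: m u em => [|m IH] u duv Du.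
    have -> : u = v.
      by case: u v duv {qv Dq Lv ub att le_L Du} => [a b] [c e];
        rewrite /dist1 /= => ?; congr pair; lia.
    exists [::]; last by rewrite big_seq1 Lv.
    by rewrite /lattice_path /= qv eqxx /dist1; lia.
  have [|w [uw qw d LE]] := att u Du.
    by apply: contra_eqN duv => /eqP ->; rewrite /dist1; lia.
  have [Dw _] := ub u w Du uw qw d.
  have [|//|p lp pE] := IH w; first by move: duv; rewrite d => -[].
  by exists (w :: p); [exact: lattice_path_cons (Dq u Du) uw d lp
    | rewrite big_cons pE LE].
move=> u Du; have [[p lp ->] M] := lpp_max x (Dq u Du) qv.
apply/le_anti; rewrite le_L //=.
by have [p' lp' <-] := ex_L u Du; have := M p' lp'.
Qed.

Lemma lpp_le x y u v e : quadrant u -> quadrant v ->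
    (forall s, quadrant s -> (s.1 <= maxn u.1 v.1)%N ->
       (s.2 <= maxn u.2 v.2)%N -> x s <= y s + e) ->
  lpp x u v <= lpp y u v + e *+ (dist1 u v).+1.
Proof.
move=> qu qv xy; have [[p lp ->] _] := lpp_max x qu qv.
have [_ M] := lpp_max y qu qv.
have /and4P[_ _ _ /eqP sp] := lp.
apply: (le_trans _ (lerD (M p lp) (lexx _))).
have -> : e *+ (dist1 u v).+1 = \sum_(s <- u :: p) e.
  by rewrite big_const_seq count_predT iter_addr_0 /= sp.
rewrite -big_split /=.
rewrite big_seq [leRHS]big_seq; apply: ler_sum => s /(lattice_path_box lp)[] *.
exact: xy.
Qed.

Variable (h : R) (h0 : 0 <= h) (x : nat -> nat -> nat).

Definition scaled_weight (s : site) : R := h * (x s.1.-1 s.2.-1)%:R.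

Lemma lpp_rsk a b : (0 < a)%N -> (0 < b)%N ->
  lpp scaled_weight (1%N, 1%N) (a, b) = h * (growth rsk_rule x a b 0)%:R.
Proof.
(* Reversal makes [(1, 1)] the target, so a step of the path goes to a predecessor in the growth
   diagram. *)
move=> a0 b0; rewrite lpp_sym //; last by rewrite /quadrant a0.
apply: (lpp_recursion (L := fun u => h * (growth rsk_rule x u.1 u.2 0)%:R)
  (D := quadrant)) => //.
- by rewrite /scaled_weight /= addn0.
- move=> [[|i] [|j]] [i' j'] // _ uw qw duv; split => //.
  rewrite /scaled_weight -mulrDr -natrD ler_wpM2l // ler_nat.
  rewrite [i.+1.-1]/= [j.+1.-1]/=.
  rewrite [(i.+1, j.+1).1]/= [(i.+1, j.+1).2]/= rsk_growth0 leq_add2l.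
  rewrite [(i', j').1]/= [(i', j').2]/=.
  move: uw qw duv; rewrite /adjacent /quadrant /dist1 /= => uw qw duv.
  have [E|E] : (i' = i.+1 /\ j' = j) \/ (i' = i /\ j' = j.+1) by lia.
    by case: E => -> ->; rewrite leq_maxr.
  by case: E => -> ->; rewrite leq_maxl.
- move=> [[|i] [|j]] // _ uv.
  rewrite [(i.+1, j.+1).1]/= [(i.+1, j.+1).2]/= rsk_growth0 natrD mulrDr.
  have [w [uw qw duv ->]] : exists w : site, [/\ adjacent (i.+1, j.+1) w,
      quadrant w, dist1 (i.+1, j.+1) (1%N, 1%N) = (dist1 w (1%N, 1%N)).+1 &
      maxn (growth rsk_rule x i j.+1 0) (growth rsk_rule x i.+1 j 0) =
      growth rsk_rule x w.1 w.2 0].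
    have [i0|i0] := posnP i.
      exists (1%N, j); rewrite i0 growth0l max0n.
      have j0 : (0 < j)%N by case: (j) uv i0 => [|//]; case: (i).
      split=> //; rewrite /adjacent /dist1 /quadrant /=; lia.
    have [j0|j0] := posnP j.
      exists (i, 1%N); rewrite j0 growth0r maxn0.
      split=> //; rewrite /adjacent /dist1 /quadrant /=; lia.
    have [le|lt] := leqP (growth rsk_rule x i j.+1 0)
      (growth rsk_rule x i.+1 j 0).
      exists (i.+1, j); split=> //; rewrite /adjacent /dist1 /quadrant /=; lia.
    exists (i, j.+1); split=> //; rewrite /adjacent /dist1 /quadrant /=; lia.
  by exists w.
- by rewrite /quadrant a0.
Qed.

Lemma lpp_burge a b : (0 < a)%N -> (0 < b)%N ->
  lpp scaled_weight (a, 1%N) (1%N, b) = h * (growth burge_rule x a b 0)%:R.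
Proof.
move=> a0 b0; rewrite burge_growth0.
(* [L i c] is the unscaled passage time from [(i, c + 1)] to [(1, b)]. *)
pose L i c := add_rows (fun k i => x i (c + k)%N) (b - c) (fun=> 0%N) i.
have LE i c : (c < b)%N ->
    L i.+1 c = (x i c + maxn (L i.+1 c.+1) (L i c))%N.
  move=> cb; rewrite /L; have -> : (b - c = (b - c.+1).+1)%N by lia.
  by rewrite add_rowsSl add_rowS addn0; under eq_fun do rewrite addnS -addSn.
have L0 c : L 0%N c = 0%N.
  by rewrite /L; case: (b - c)%N => // m; rewrite add_rowsSl.
have Lb i : L i b = 0%N by rewrite /L subnn.
rewrite -[add_rows _ _ _ _]/
  (add_rows (fun k i => x i (0 + k)%N) b (fun=> 0%N) a).
rewrite -{2}[b]subn0 -/(L a 0%N).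
apply: (lpp_recursion (L := fun u => h * (L u.1 u.2.-1)%:R)
  (D := fun u => quadrant u && (u.2 <= b)%N)) => //.
- by move=> u /andP[].
- by rewrite /scaled_weight /= LE ?prednK // L0 Lb maxn0 addn0.
- move=> [[|i] [|j]] [i' j'] // /andP[_ /= jb] uw qw duv.
  move: uw qw duv; rewrite /adjacent /quadrant /dist1 /= => uw qw duv.
  have E : (i' = i.+1 /\ j' = j.+2) \/ (i' = i /\ j' = j.+1) by lia.
  split; first by lia.
  rewrite /scaled_weight -mulrDr -natrD ler_wpM2l // ler_nat LE // leq_add2l.
  by case: E => -[-> ->] /=; rewrite ?leq_maxl ?leq_maxr.
- move=> [[|i] [|j]] // /andP[_ /= jb] uv.
  rewrite LE // natrD mulrDr.
  have [w [uw qw duv ->]] : exists w : site, [/\ adjacent (i.+1, j.+1) w,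
      quadrant w, dist1 (i.+1, j.+1) (1%N, b) = (dist1 w (1%N, b)).+1 &
      maxn (L i.+1 j.+1) (L i j) = L w.1 w.2.-1].
    have [i0|i0] := posnP i.
      exists (1%N, j.+2); rewrite i0 L0 maxn0.
      have jb' : (j.+1 < b)%N.
        by rewrite ltn_neqAle jb andbT; apply: contraNneq uv => <-; rewrite i0.
      split=> //; rewrite /adjacent /dist1 /quadrant /=; lia.
    have [j0|j0] := eqVneq j.+1 b.
      exists (i, j.+1); rewrite j0 Lb max0n -j0.
      split=> //; rewrite /adjacent /dist1 /quadrant /=; lia.
    have [le|lt] := leqP (L i.+1 j.+1) (L i j).
      exists (i, j.+1); split=> //; rewrite /adjacent /dist1 /quadrant /=; lia.
    exists (i.+1, j.+2); split=> //; rewrite /adjacent /dist1 /quadrant /=; lia.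
  by exists w.
- by rewrite /quadrant a0.
Qed.

End lpp.

(** * Laws of random tuples *)

Definition orthant {R : realType} {m : nat} (t : 'I_m -> R) :
    set (m.-tuple R) :=
  [set y | forall i, tnth y i <= t i].

Section orthants.
Context {R : realType} {m : nat}.

Lemma measurable_orthant (t : 'I_m -> R) : measurable (orthant t).
Proof.
rewrite (_ : orthant t =
    \bigcap_(i in [set: 'I_m]) (@tnth m R ^~ i @^-1` `]-oo, t i])).
  apply: fin_bigcap_measurable; first exact: finite_finset.
  by move=> i _; rewrite -[X in measurable X]setTI; exact: measurable_tnth.
by apply/seteqP; split => [y yt i _|y yt i]; [|have := yt i Logic.I];
  rewrite /= in_itv /=.
Qed.

(** Letting all other bounds tend to infinity recovers a half-space, so the orthants generate the
    measurable sets. *)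
Lemma bigcup_orthant (F : nat -> 'I_m -> R) (i : 'I_m) (r : R) :
    (forall k, F k i = r) -> (forall k j, j != i -> F k j = k%:R) ->
  \bigcup_k orthant (F k) = @tnth m R ^~ i @^-1` `]-oo, r].
Proof.
move=> Fi Fj; apply/seteqP; split => [y [k _ yk]|y] /=; rewrite in_itv /=.
  by rewrite -(Fi k).
move=> yr.
pose k := \max_(j < m) Num.truncn (tnth y j); exists k.+1 => // j.
have [->|ji] := eqVneq j i; first by rewrite Fi.
rewrite Fj //; apply/ltW/(lt_le_trans (truncnS_gt _)).
rewrite ler_nat ltnS.
exact: (leq_bigmax (F := fun j => Num.truncn (tnth y j))).
Qed.

Lemma measurable_orthantE :
  @measurable _ (m.-tuple R) = <<s range (@orthant R m) >>.
Proof.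
apply/seteqP; split; last first.
  apply: smallest_sub; first exact: sigma_algebra_measurable.
  by move=> _ [t _ <-]; exact: measurable_orthant.
have : measurable_fun setT
    (id : g_sigma_algebraType (range (@orthant R m)) -> m.-tuple R).
  apply/measurable_fun_tnthP => i.
  apply: (measurability (@RGenOInfty.G R)); first exact: RGenOInfty.measurableE.
  move=> _ [_] [r] -> <-; rewrite setTI.
  pose F (k : nat) j : R := if j == i then r else k%:R.
  rewrite (_ : _ @^-1` _ = ~` \bigcup_k orthant (F k)).
    apply: measurableC; apply: bigcup_measurable => k _.
    by apply: sub_sigma_algebra; exists (F k).
  rewrite (@bigcup_orthant _ i r); first last.
  - by move=> k j /negbTE ji; rewrite /F ji.
  - by move=> k; rewrite /F eqxx.
  by apply/seteqP; split => y /=; rewrite !in_itv /= andbT;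
    [rewrite ltNge => /negP|move/negP; rewrite -ltNge].
by move=> mid A mA; have := mid measurableT A mA; rewrite setTI preimage_id.
Qed.

End orthants.

(** The orthants are stable under intersection, generate the measurable sets and exhaust the space,
    so a finite measure is determined on them. *)
Lemma eq_in_law_orthant {d} {T : measurableType d} {R : realType}
    (P : probability T R) m (X Y : {RV P >-> m.-tuple R}) :
    (forall t : 'I_m -> R, P (X @^-1` orthant t) = P (Y @^-1` orthant t)) ->
  eq_in_law X Y.
Proof.
move=> XY A mA.
apply: (measure_unique (range (@orthant R m))
  (fun k => orthant (fun=> k%:R))) => //.
- exact: measurable_orthantE.
- move=> _ _ [s _ <-] [t _ <-]; exists (fun i => Num.min (s i) (t i)) => //.
  apply/seteqP; split => [y st|y [sy ty] i]; last by rewrite le_min sy ty.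
  by split => i; have := st i; rewrite le_min => /andP[].
- apply/seteqP; split => // y _.
  exists (\max_(j < m) Num.truncn (tnth y j)).+1 => // j.
  apply/ltW/(lt_le_trans (truncnS_gt _)).
  rewrite ler_nat ltnS.
  exact: (leq_bigmax (F := fun j => Num.truncn (tnth y j))).
- by move=> _ [t _ <-]; exact: XY.
- move=> k; apply: (le_lt_trans (probability_le1 _ _)); rewrite ?ltry //.
  exact: measurable_orthant.
Qed.

(** * Exponential variables *)

Section exponential_variable.
Context {d} {T : measurableType d} {R : realType} (P : probability T R).
Variables (Y : {RV P >-> R}) (Yexp : has_law Y (exponential_prob 1)).

Let measurable_preimage (A : set R) : measurable A -> measurable (Y @^-1` A).
Proof.
by move=> mA; rewrite -[X in measurable X]setTI; exact: measurable_funPT.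
Qed.

Let lawE (A : set R) : measurable A -> P (Y @^-1` A) = exponential_prob 1 A.
Proof. by move=> mA; rewrite -(Yexp mA). Qed.

Lemma exponential_set0 : P (Y @^-1` [set 0]) = 0%E.
Proof. by rewrite lawE // /exponential_prob integral_set1. Qed.

Lemma exponential_le0 : P (Y @^-1` `]-oo, 0]) = 0%E.
Proof.
apply/eqP; rewrite -measure_le0.
rewrite (_ : `]-oo, 0]%classic = `]-oo, 0[%classic `|` [set 0]); last first.
  by rewrite setUitv1 // bnd_simp.
rewrite preimage_setU.
have m1 := measurable_preimage (measurable_itv `]-oo, (0 : R)[).
have m2 := measurable_preimage (measurable_set1 (0 : R)).
apply: le_trans (measureU2 P m1 m2) (adde_le0 _ _); last first.
  by rewrite le_eqVlt; apply/orP; left; apply/eqP; exact: exponential_set0.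
rewrite le_eqVlt; apply/orP; left; apply/eqP.
apply: etrans (lawE (measurable_itv _)) _.
rewrite /exponential_prob integral0_eq // => x /=.
by rewrite in_itv /= => x0; rewrite lt0_exponential_pdf.
Qed.

Lemma exponential_0c a : 0 <= a -> P (Y @^-1` `[0, a]) = (1 - expR (- a))%:E.
Proof.
rewrite le_eqVlt => /predU1P[<-|a0].
  by rewrite oppr0 expR0 subrr set_itv1 exponential_set0.
rewrite lawE // exponential_prob_itv0c //.
by rewrite mulN1r.
Qed.

Lemma exponential_oc a b : 0 <= a -> a <= b ->
  P (Y @^-1` `]a, b]) = (expR (- a) - expR (- b))%:E.
Proof.
move=> a0 ab.
have -> : `]a, b]%classic = `[0, b] `\` `[0, a].
  apply/seteqP; split => x /=; rewrite !in_itv /=.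
    by move=> /andP[ax ->]; split; [rewrite andbT|]; lra.
  by move=> [/andP[x0 ->]]; rewrite x0 /= andbT ltNge => /negP.
have -> : Y @^-1` (`[0, b] `\` `[0, a]) =
  Y @^-1` `[0, b] `\` Y @^-1` `[0, a] by [].
rewrite measureD; try exact: measurable_preimage.
  rewrite setIidr; last first.
    apply: preimage_subset => x /=; rewrite !in_itv /= => /andP[-> xa].
    exact: le_trans ab.
  apply: etrans (congr2 (fun u v => u - v)%E
    (exponential_0c (le_trans a0 ab)) (exponential_0c a0)) _.
  by rewrite -EFinB; congr EFin; ring.
apply: le_lt_trans (probability_le1 _ _) _; rewrite ?ltry //.
exact: measurable_preimage.
Qed.

(** The law is geometric in [k]. A product over independent sites therefore depends on the integer
    coordinates only through their sum. *)
Lemma exponential_cell (h : R) (k : nat) : 0 <= h ->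
  P (Y @^-1` `]h * k%:R, h * k.+1%:R]) =
  (expR (- h) ^+ k * (1 - expR (- h)))%:E.
Proof.
move=> h0; rewrite exponential_oc ?mulr_ge0 ?ler_wpM2l ?ler_nat //.
have E m : expR (- (h * m%:R)) = expR (- h) ^+ m.
  by rewrite -mulNr mulrC expRM_natl.
by rewrite !E exprS; congr EFin; ring.
Qed.

End exponential_variable.

(** * Comparison of the distribution functions *)

Lemma ex_cell (R : realType) (h y : R) : 0 < h -> 0 < y ->
  exists k : nat, h * k%:R < y <= h * k.+1%:R.
Proof.
move=> h0 y0.
have ex : exists m, y <= h * m%:R.
  exists (Num.truncn (y / h)).+1; rewrite mulrC -ler_pdivrMr //.
  exact/ltW/truncnS_gt.
case: (ex_minnP ex) => -[|k] yk kmin; first by rewrite mulr0 leNgt y0 in yk.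
exists k; rewrite yk andbT ltNge; apply/negP => /kmin.
by rewrite ltnn.
Qed.

(** What the comparison uses of either rule: every path stays inside the staircase, it has at most
    [d + 1] sites, and for discretized weights its passage time is a first part on antidiagonal
    [d + 1]. *)
Definition growth_lpp {R : realType} (d : nat) (F : growth_rule)
    (u v : 'I_d -> site) := forall k : 'I_d,
  [/\ quadrant (u k) && quadrant (v k),
      (maxn (u k).1 (v k).1 + maxn (u k).2 (v k).2 <= d.+1)%N,
      (dist1 (u k) (v k) <= d)%N
    & forall (h : R) x, 0 <= h -> lpp (scaled_weight h x) (u k) (v k) =
        h * (growth F x (d - k)%N k.+1 0)%:R].

Section environment.
Context {dd : measure_display} {T : measurableType dd} {R : realType}.
Context {P : probability T R}.
Variables (X : site -> {RV P >-> R}) (iidX : iid_exponential X) (d : nat).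

Let J := staircase d.

Let quadrantJ s : s \in J -> quadrant s.
Proof. by rewrite mem_staircase => /andP[]. Qed.

Let lawX s : s \in J -> has_law (X s) (exponential_prob 1).
Proof. by move=> /quadrantJ; exact: iidX.2. Qed.

Let measurable_preimage s (A : set R) :
  measurable A -> measurable (X s @^-1` A).
Proof.
by move=> mA; rewrite -[X in measurable X]setTI; exact: measurable_funPT.
Qed.

(** With intervals open on the left, the cells for [0 < h] cover exactly the outcomes with positive
    staircase weights; the rest is negligible. *)
Definition cell (h : R) (x : nat -> nat -> nat) : set T :=
  \bigcap_(s in [set` J]) (X s @^-1`
    `]h * (x s.1.-1 s.2.-1)%:R, h * (x s.1.-1 s.2.-1).+1%:R]).

Lemma measurable_cell h x : measurable (cell h x).
Proof.
apply: fin_bigcap_measurable; first exact: finite_fset.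
by move=> s _; exact: measurable_preimage.
Qed.

Lemma probability_cell h x : 0 <= h -> P (cell h x) =
  (expR (- h) ^+ staircase_sum d x * (1 - expR (- h)) ^+ #|` J|)%:E.
Proof.
move=> h0; rewrite /cell.
pose A (s : site) :=
  `]h * (x s.1.-1 s.2.-1)%:R, h * (x s.1.-1 s.2.-1).+1%:R]%classic.
have AJ s : s \in J -> measurable (A s) by move=> _; exact: measurable_itv.
rewrite (iidX.1 J A quadrantJ AJ).
rewrite big_seq (eq_bigr (fun s : site =>
  (expR (- h) ^+ x s.1.-1 s.2.-1 * (1 - expR (- h)))%:E)); last first.
  by move=> s sJ; exact: exponential_cell (lawX sJ) _ _ h0.
rewrite -big_seq prodEFin big_split /=; congr (_ * _)%:E.
  by rewrite -staircase_sumE expr_sum.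
by rewrite big_const_seq count_predT iter_mulr_1.
Qed.

Lemma cell_disjoint h x y w : 0 < h -> cell h x w -> cell h y w ->
  forall i j, (i + j < d)%N -> x i j = y i j.
Proof.
move=> h0 xw yw i j ijd.
have sJ : (i.+1, j.+1) \in J by rewrite mem_staircase /quadrant /=; lia.
have := xw _ sJ; have := yw _ sJ; rewrite /= !in_itv /=.
move=> /andP[y1 y2] /andP[x1 x2].
have := lt_le_trans x1 y2; have := lt_le_trans y1 x2.
by rewrite !ltr_pM2l // !ltr_nat; lia.
Qed.

Lemma cell_ex h w : 0 < h -> (forall s, s \in J -> 0 < X s w) ->
  exists x, cell h x w.
Proof.
move=> h0 Xw.
have /choice[f fP] (s : site) : exists k : nat, s \in J ->
    h * k%:R < X s w <= h * k.+1%:R.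
  have [sJ|_] := boolP (s \in J); last by exists 0%N.
  by have [k kP] := ex_cell h0 (Xw s sJ); exists k.
exists (fun i j => f (i.+1, j.+1)) => s sJ.
have /andP[s1 s2] := quadrantJ sJ.
by rewrite /= in_itv /= !prednK // -surjective_pairing fP.
Qed.

Lemma negligible_nonpositive :
  P.-negligible [set w | exists2 s, s \in J & X s w <= 0].
Proof.
suff H (l : seq site) : {subset l <= J} ->
    P.-negligible [set w | exists2 s, s \in l & X s w <= 0].
  by apply: (H (enum_fset J)) => s.
elim: l => [_|s l IH sub].
  apply: (negligibleS (A := set0)); last exact: negligible_set0.
  by move=> w [s]; rewrite in_nil.
have sJ : s \in J by apply: sub; rewrite mem_head.
have lJ : {subset l <= J}.
  by move=> s' s'l; apply: sub; rewrite in_cons s'l orbT.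
apply: negligibleS
  (negligibleU (_ : P.-negligible (X s @^-1` `]-oo, 0])) (IH lJ)).
  move=> w [s']; rewrite in_cons => /orP[/eqP ->|s'l] Xw.
    by left; rewrite /= in_itv.
  by right; exists s'.
apply/negligibleP; first exact: measurable_preimage.
exact: exponential_le0 (lawX sJ).
Qed.

Section box.
Variables (h : R) (h0 : 0 < h) (F : growth_rule) (u v : 'I_d -> site).
Hypothesis FL : growth_lpp (R := R) F u v.

Let box k s : quadrant s -> (s.1 <= maxn (u k).1 (v k).1)%N ->
  (s.2 <= maxn (u k).2 (v k).2)%N -> s \in J.
Proof. by have [_ uv _ _] := FL k; rewrite mem_staircase => -> /=; lia. Qed.

Lemma cell_lpp_ge x w (k : 'I_d) : cell h x w ->
  h * (growth F x (d - k)%N k.+1 0)%:R <= lpp (X ^~ w) (u k) (v k).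
Proof.
move=> xw; have [/andP[qu qv] _ _ E] := FL k; rewrite -(E _ _ (ltW h0)).
have := lpp_le (x := scaled_weight h x) (y := X ^~ w) (e := 0) qu qv.
rewrite mul0rn addr0; apply=> s qs s1 s2; rewrite addr0.
by have := xw _ (box qs s1 s2); rewrite /= in_itv /= => /andP[/ltW].
Qed.

Lemma cell_lpp_le x w (k : 'I_d) : cell h x w -> lpp (X ^~ w) (u k) (v k) <=
  h * (growth F x (d - k)%N k.+1 0)%:R + h *+ d.+1.
Proof.
move=> xw; have [/andP[qu qv] _ uvd E] := FL k; rewrite -(E _ _ (ltW h0)).
apply: (@le_trans _ _ (lpp (scaled_weight h x) (u k) (v k)
    + h *+ (dist1 (u k) (v k)).+1)); last first.
  by rewrite lerD2l ler_pMn2l.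
apply: lpp_le => // s qs s1 s2.
have := xw _ (box qs s1 s2); rewrite /= in_itv /= => /andP[_].
by rewrite -natr1 mulrDr mulr1.
Qed.

End box.

Definition lpp_below (u v : 'I_d -> site) (t : 'I_d -> R) : set T :=
  [set w | forall k, lpp (X ^~ w) (u k) (v k) <= t k].

Lemma lpp_belowE u v t : lpp_below u v t = lpp_vector X u v @^-1` orthant t.
Proof.
by apply/seteqP; split => w wt k; have := wt k; rewrite /= tnth_mktuple.
Qed.

Lemma measurable_lpp_below u v t : measurable (lpp_below u v t).
Proof.
rewrite lpp_belowE -[X in measurable X]setTI.
by apply: measurable_lpp_vector => //; exact: measurable_orthant.
Qed.

Section discretization.
Variables (h : R) (h0 : 0 < h) (t : 'I_d -> R) (B : nat).

Definition cells (F : growth_rule) : set T :=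
  \bigcup_(x in [set` small_arrays B h t F]) cell h (array_ext x).

Lemma measurable_cells F : measurable (cells F).
Proof.
apply: fin_bigcup_measurable; first exact: finite_finset.
by move=> x _; exact: measurable_cell.
Qed.

Lemma probability_cells F : P (cells F) = (\sum_(x in small_arrays B h t F)
  expR (- h) ^+ staircase_sum d (array_ext x) * (1 - expR (- h)) ^+ #|` J|)%:E.
Proof.
rewrite /cells (_ : [set` _] = [set` enum (small_arrays B h t F)]); last first.
  by apply/seteqP; split => x /=; rewrite mem_enum.
rewrite measure_fin_bigcup.
- rewrite -fsbig_seq ?enum_uniq // big_enum /= -sumEFin.
  by apply: eq_bigr => x _; rewrite probability_cell ?ltW.
- exact: finite_seq.
- apply/trivIsetP => x y _ _ /eqP xy; apply/seteqP; split => // w [xw yw].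
  by apply: xy; apply: array_ext_inj; exact: cell_disjoint h0 xw yw.
- by move=> x _; exact: measurable_cell.
Qed.

Lemma probability_cells_le F G : growth_bijection F -> growth_bijection G ->
  (P (cells F) <= P (cells G))%E.
Proof.
move=> HF HG; rewrite !probability_cells lee_fin.
apply: (small_arrays_sum_le B h t
  (w := fun k => expR (- h) ^+ k * (1 - expR (- h)) ^+ #|` J|) HF HG) => k.
rewrite mulr_ge0 ?exprn_ge0 ?expR_ge0 // subr_ge0.
by rewrite -expR0 ler_expR oppr_le0 ltW.
Qed.

Lemma cells_lpp_below G u v : growth_lpp (R := R) G u v ->
  cells G `<=` lpp_below u v (fun k => t k + h *+ d.+1).
Proof.
move=> GL w [x /= xA xw] k.
apply: le_trans (cell_lpp_le h0 GL k xw) _; rewrite lerD2r.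
by move: xA; rewrite inE => /andP[_ /forallP].
Qed.

End discretization.

Lemma lpp_below_cells (h : R) t F u v : 0 < h -> growth_bijection F ->
    growth_lpp (R := R) F u v -> exists B,
  lpp_below u v t `<=`
  [set w | exists2 s, s \in J & X s w <= 0] `|` cells h t B F.
Proof.
move=> h0 HF FL.
(* On the event all first parts are at most [K], so [staircase_sum_bound] gives a bound on the
   weights that is uniform in [w]. *)
pose K := (\max_(k < d) Num.truncn (t k / h))%N.
exists (d.+2 * (d * K))%N => w wt.
have [wJ|wJ] := pselect (exists2 s, s \in J & X s w <= 0); [by left|right].
have [|x xw] := @cell_ex h w h0.
  by move=> s sJ; rewrite ltNge; apply/negP => Xs; apply: wJ; exists s.
have xt (k : 'I_d) : h * (growth F x (d - k)%N k.+1 0)%:R <= t k.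
  exact: le_trans (cell_lpp_ge h0 FL k xw) (wt k).
have xB : (staircase_sum d x <= d.+2 * (d * K))%N.
  apply: (staircase_sum_bound HF) => k kd.
  apply: leq_trans
    (leq_bigmax (F := fun k => Num.truncn (t k / h)) (Ordinal kd)).
  have := xt (Ordinal kd); rewrite mulrC -ler_pdivlMr //= => xt'.
  by rewrite truncn_ge_nat // (le_trans _ xt').
have xE := array_resK xB.
exists (array_res d (d.+2 * (d * K)) x).
  rewrite /= inE (eq_staircase_sum xE) xB /=; apply/forallP => k.
  by rewrite (eq_growth_staircase _ _ xE) ?xt //; have := ltn_ord k; lia.
move=> s sJ; have := xw s sJ; rewrite /= xE //.
have : s \in J := sJ; rewrite mem_staircase => /andP[/andP[]].
by case: s {sJ} => a b /=; lia.
Qed.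

(** Up to a null set the event for [F] lies in [cells F], which is at most as probable as [cells G],
    and [cells G] lies in the event for [G] with thresholds raised by [h *+ d.+1]. For
    [h = 1 / (m + 1)] these enlarged events [S m] decrease to the event itself, and continuity from
    above concludes. *)
Lemma lpp_below_le F G u v u' v' t :
    growth_bijection F -> growth_bijection G ->
    growth_lpp (R := R) F u v -> growth_lpp (R := R) G u' v' ->
  (P (lpp_below u v t) <= P (lpp_below u' v' t))%E.
Proof.
move=> HF HG FL GL.
pose S m := lpp_below u' v' (fun k => t k + m.+1%:R^-1 *+ d.+1).
have le_S m : (P (lpp_below u v t) <= P (S m))%E.
  have h0 : 0 < m.+1%:R^-1 :> R by rewrite invr_gt0.
  have [B sub] := lpp_below_cells t h0 HF FL.
  have [N [mN PN subN]] := negligible_nonpositive.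
  apply: (@le_trans _ _ (P (cells m.+1%:R^-1 t B F))).
    apply: (@le_trans _ _ (P (N `|` cells m.+1%:R^-1 t B F))).
      apply: le_measure; rewrite ?inE.
      - exact: measurable_lpp_below.
      - by apply: measurableU => //; exact: measurable_cells.
      - exact: subset_trans sub (setSU subN).
    have mC := measurable_cells m.+1%:R^-1 t B F.
    have /le_trans -> // : (P (N `|` cells m.+1%:R^-1 t B F) <=
      P N + P (cells m.+1%:R^-1 t B F))%E by exact: measureU2.
    by rewrite PN add0e.
  apply: le_trans (probability_cells_le h0 t B HF HG) _.
  apply: le_measure; rewrite ?inE.
  - exact: measurable_cells.
  - exact: measurable_lpp_below.
  - exact: cells_lpp_below.
have SE : \bigcap_m S m = lpp_below u' v' t.
  apply/seteqP; split => [w Sw k|w wt m _ k]; last first.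
    by apply: le_trans (wt k) _; rewrite lerDl mulrn_wge0 // invr_ge0.
  apply/ler_addgt0Pl => e e0; rewrite addrC.
  (* Chosen so that the excess [(d + 1) / (m + 1)] is at most [e]. *)
  pose m := Num.truncn (d.+1%:R / e).
  apply: le_trans (Sw m Logic.I k) _; rewrite lerD2l.
  rewrite -(mulr_natl _ d.+1) ler_pdivrMr // mulrC -ler_pdivrMr //.
  exact/ltW/truncnS_gt.
rewrite -SE; have cv : P \o S @ \oo --> P (\bigcap_m S m).
  apply: nonincreasing_cvg_mu.
  - apply: le_lt_trans (probability_le1 P _) (ltry 1).
    exact: measurable_lpp_below.
  - by move=> m; exact: measurable_lpp_below.
  - by rewrite SE; exact: measurable_lpp_below.
  - move=> m m' mm'; apply/subsetPset => w Sw k; apply: le_trans (Sw k) _.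
    by rewrite lerD2l lerMn2r lef_pV2 ?posrE // ler_nat ltnS mm' orbT.
apply: (cvge_to_ge cv).
by apply: nearW => m; exact: le_S.
Qed.

End environment.

Theorem theorem1p1 (d : measure_display) (T : measurableType d)
    (R : realType) (P : probability T R) (X : site -> {RV P >-> R}) (n : nat) :
  iid_exponential X -> (2 <= n)%N ->
  eq_in_law (point_to_line X n) (line_to_line X n).
Proof.
move=> iidX; case: n => // n n2.
(* [n] now denotes the number of entries; with [d = n] the [k]-th entry belongs to the site
   [(n - k, k + 1)] of antidiagonal [n + 1]. *)
have VL : growth_lpp (R := R) rsk_rule (fun i : 'I_n => (1%N, 1%N))
    (fun i : 'I_n => ((n.+1 - i.+1)%N, i.+1)).
  move=> k; have kn := ltn_ord k; rewrite /quadrant /dist1 /=.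
  split; [lia|lia|lia|] => h x h0.
  by rewrite lpp_rsk // ?subSS // subn_gt0.
have WL : growth_lpp (R := R) burge_rule
    (fun i : 'I_n => ((n.+1 - i.+1)%N, 1%N))
    (fun i : 'I_n => (1%N, i.+1)).
  move=> k; have kn := ltn_ord k; rewrite /quadrant /dist1 /=.
  split; [lia|lia|lia|] => h x h0.
  by rewrite lpp_burge // ?subSS // subn_gt0.
apply: eq_in_law_orthant => t.
rewrite /point_to_line /line_to_line -!lpp_belowE.
have HF := rsk_growth_bijection; have HG := burge_growth_bijection.
apply/le_anti; rewrite (lpp_below_le iidX t HF HG VL WL).
by rewrite (lpp_below_le iidX t HG HF WL VL).
Qed.
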